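(* The power series homomorphism $\overline{R}\to\mathbf{k}\llbracket E_1,E_2\rrbracket$, which fixes $E_1,E_2$ and sends the generators $\rho_0,\rho_1$ to the power series of the same name, takes $\overline{R}$ isomorphically onto the subring $R$ of $\mathbf{k}\llbracket E_1,E_2\rrbracket$. Moreover, $R$ has a basis over $\mathbb{Z}[E_1,E_2]$ given by $$\mathscr{B}=\{\rho_1^{n_1}\rho_0^{n_2}\rho^{n_3}\ :\ n_1\in\{0,1\},\ n_2\in\mathbb{Z}_{\ge0},\ n_3\in\mathbb{Z}\}.$$
   Context: $\mathbf{k}=\mathbb{Z}[\beta_{k,\ell}:k,\ell\in\mathbb{Z}_{\ge0},(k,\ell)\ne(0,0)]$ is the polynomial ring in independent variables $\beta_{k,\ell}$ (of degree $-2(k+\ell)$). $p(x,y)=1+\sum_{(k,\ell)\ne(0,0)}\beta_{k,\ell}x^ky^\ell\in\mathbf{k}\llbracket x,y\rrbracket$, $p_{12}=p(x_1,x_2)$, $p_{21}=p(x_2,x_1)$, $E_1=x_1+x_2$, $E_2=x_1x_2$, and $\mathbf{k}\llbracket E_1,E_2\rrbracket=\mathbf{k}\llbracket x_1,x_2\rrbracket^{S_2}$. In this ring consider $$\rho_0=\frac{p_{12}-p_{21}}{x_1-x_2},\quad\rho_1=\frac{x_1p_{12}-x_2p_{21}}{x_1-x_2},\quad\rho=-p_{12}p_{21},$$ which satisfy $\rho=-(\rho_1^2-E_1\rho_1\rho_0+E_2\rho_0^2)$; $\rho$ is invertible. $R\subset\mathbf{k}\llbracket E_1,E_2\rrbracket$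 is the subring generated over $\mathbb{Z}$ by $E_1,E_2,\rho_0,\rho_1,\rho^{\pm1}$. $\overline{R}=\mathbb{Z}[E_1,E_2,\rho_0,\rho_1,(\rho_1^2-E_1\rho_1\rho_0+E_2\rho_0^2)^{-1}]$ is the localization of the polynomial ring in four independent generators $E_1,E_2,\rho_0,\rho_1$ at the indicated element. *)

(* Defs.v *)
From HB Require Import structures.
From mathcomp Require Import all_boot all_order all_algebra.
From mathcomp Require Import boolp.
From mathcomp Require Import monalg mpoly.
From mathcomp Require Import ring.

Set Implicit Arguments.
Unset Strict Implicit.
Unset Printing Implicit Defensive.

Import GRing.Theory.
Local Open Scope ring_scope.

(* [fcoef f i j] is the coefficient of x1^i x2^j. *)
Record fps2 (K : Type) := FPS2 { fcoef : nat -> nat -> K }.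

Lemma fps2P (K : Type) (f g : fps2 K) :
  (forall i j, fcoef f i j = fcoef g i j) <-> f = g.
Proof.
split=> [|-> //]; case: f g => [f] [g] /= fg.
by congr FPS2; apply/funext => i; apply/funext => j.
Qed.

HB.instance Definition _ (K : Type) := gen_eqMixin (fps2 K).
HB.instance Definition _ (K : Type) := gen_choiceMixin (fps2 K).

Section PowerSeriesRing.
Variable K : comNzRingType.
Implicit Types f g h : fps2 K.

Definition fps2_zero : fps2 K := FPS2 (fun _ _ => 0).
Definition fps2_opp f : fps2 K := FPS2 (fun i j => - fcoef f i j).
Definition fps2_add f g : fps2 K := FPS2 (fun i j => fcoef f i j + fcoef g i j).

Lemma fps2_addA : associative fps2_add.
Proof. by move=> f g h; apply/fps2P => i j /=; rewrite addrA. Qed.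
Lemma fps2_addC : commutative fps2_add.
Proof. by move=> f g; apply/fps2P => i j /=; rewrite addrC. Qed.
Lemma fps2_add0 : left_id fps2_zero fps2_add.
Proof. by move=> f; apply/fps2P => i j /=; rewrite add0r. Qed.
Lemma fps2_addN : left_inverse fps2_zero fps2_opp fps2_add.
Proof. by move=> f; apply/fps2P => i j /=; rewrite addNr. Qed.

HB.instance Definition _ := GRing.isZmodule.Build (fps2 K)
  fps2_addA fps2_addC fps2_add0 fps2_addN.

Definition fps2_one : fps2 K :=
  FPS2 (fun i j => ((i == 0%N) && (j == 0%N))%:R).

Definition fps2_mul f g : fps2 K :=
  FPS2 (fun i j => \sum_(b < j.+1) \sum_(a < i.+1)
                     fcoef f a b * fcoef g (i - a) (j - b)).

(* The ring axioms are transported from {poly {poly K}} by truncation. *)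
Let trunc n f : {poly {poly K}} :=
  \poly_(j < n) \poly_(i < n) fcoef f i j.

Let coef_trunc n f i j : (i < n)%N -> (j < n)%N ->
  (trunc n f)`_j`_i = fcoef f i j.
Proof. by move=> hi hj; rewrite !coef_poly hj coef_poly hi. Qed.

Let coefM2 (p q : {poly {poly K}}) i j :
  (p * q)`_j`_i =
    \sum_(b < j.+1) \sum_(a < i.+1) p`_b`_a * q`_(j - b)`_(i - a).
Proof. by rewrite coefM coef_sum; apply: eq_bigr => b _; rewrite coefM. Qed.

Let agree n (p : {poly {poly K}}) f :=
  forall i j, (i < n)%N -> (j < n)%N -> p`_j`_i = fcoef f i j.

Let agreeM n p q f g :
  agree n p f -> agree n q g -> agree n (p * q) (fps2_mul f g).
Proof.
move=> pf qg i j hi hj; rewrite coefM2 /=.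
apply: eq_bigr => b _; apply: eq_bigr => a _.
have [ha hb] := (ltn_ord a, ltn_ord b); rewrite !ltnS in ha hb.
by rewrite pf ?qg // ?(leq_ltn_trans (leq_subr _ _)) //
  ?(leq_ltn_trans ha) ?(leq_ltn_trans hb).
Qed.

Let agree_trunc n f : agree n (trunc n f) f.
Proof. by move=> i j; apply: coef_trunc. Qed.

Let agree_eq f g :
  (forall n, exists2 p, agree n p f & agree n p g) -> f = g.
Proof.
move=> H; apply/fps2P => i j; have [p pf pg] := H (i + j).+1.
by rewrite -pf -?pg // ltnS ?leq_addr ?leq_addl.
Qed.

Let agree1 n : agree n 1 fps2_one.
Proof.
move=> i j _ _; rewrite /= coef1.
by case: j => [|j]; rewrite ?andbF ?andbT ?coef0 //= coef1.
Qed.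

Let agreeD n p q f g :
  agree n p f -> agree n q g -> agree n (p + q) (fps2_add f g).
Proof. by move=> pf qg i j hi hj; rewrite !coefD pf ?qg. Qed.

Lemma fps2_mulA : associative fps2_mul.
Proof.
move=> f g h; apply: agree_eq => n.
exists (trunc n f * trunc n g * trunc n h); last by do 2?apply: agreeM.
by rewrite -mulrA; do 2?apply: agreeM.
Qed.

Lemma fps2_mulC : commutative fps2_mul.
Proof.
move=> f g; apply: agree_eq => n; exists (trunc n f * trunc n g).
  exact: agreeM.
by rewrite mulrC; apply: agreeM.
Qed.

Lemma fps2_mul1 : left_id fps2_one fps2_mul.
Proof.
move=> f; apply: agree_eq => n; exists (trunc n f) => //.
by rewrite -[trunc n f]mul1r; apply: agreeM.
Qed.

Lemma fps2_mulDl : left_distributive fps2_mul fps2_add.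
Proof.
move=> f g h; apply: agree_eq => n.
exists ((trunc n f + trunc n g) * trunc n h).
  by apply: agreeM => //; apply: agreeD.
by rewrite mulrDl; apply: agreeD; apply: agreeM.
Qed.

Lemma fps2_oner_neq0 : fps2_one != 0.
Proof.
by apply/eqP => /fps2P/(_ 0%N 0%N) /= /eqP; rewrite oner_eq0.
Qed.

HB.instance Definition _ := GRing.Zmodule_isComNzRing.Build (fps2 K)
  fps2_mulA fps2_mulC fps2_mul1 fps2_mulDl fps2_oner_neq0.

Lemma fcoef0 i j : fcoef (0 : fps2 K) i j = 0. Proof. by []. Qed.
Lemma fcoefN f i j : fcoef (- f) i j = - fcoef f i j. Proof. by []. Qed.
Lemma fcoefD f g i j : fcoef (f + g) i j = fcoef f i j + fcoef g i j.
Proof. by []. Qed.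
Lemma fcoefB f g i j : fcoef (f - g) i j = fcoef f i j - fcoef g i j.
Proof. by []. Qed.
Lemma fcoef1 i j : fcoef (1 : fps2 K) i j = ((i == 0%N) && (j == 0%N))%:R.
Proof. by []. Qed.
Lemma fcoefM f g i j : fcoef (f * g) i j =
  \sum_(b < j.+1) \sum_(a < i.+1) fcoef f a b * fcoef g (i - a) (j - b).
Proof. by []. Qed.

Definition x1 : fps2 K := FPS2 (fun i j => ((i == 1%N) && (j == 0%N))%:R).
Definition x2 : fps2 K := FPS2 (fun i j => ((i == 0%N) && (j == 1%N))%:R).

Lemma fcoef_x1M f i j :
  fcoef (x1 * f) i j = if i is i'.+1 then fcoef f i' j else 0.
Proof.
rewrite fcoefM big_ord_recl /= [X in _ + X]big1 ?addr0; last first.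
  by move=> b _; rewrite big1 // => a _; rewrite andbF mul0r.
case: i => [|i]; first by rewrite big_ord1 mul0r.
rewrite !big_ord_recl /= mul0r add0r mul1r big1 ?addr0; last first.
  by move=> a _; rewrite mul0r.
by rewrite /bump /= subn0 addn0 subSS subn0.
Qed.

Lemma fcoef_x2M f i j :
  fcoef (x2 * f) i j = if j is j'.+1 then fcoef f i j' else 0.
Proof.
rewrite fcoefM exchange_big big_ord_recl /= [X in _ + X]big1 ?addr0; last first.
  by move=> a _; rewrite big1 // => b _; rewrite mul0r.
case: j => [|j]; first by rewrite big_ord1 mul0r.
rewrite !big_ord_recl /= mul0r add0r mul1r big1 ?addr0; last first.
  by move=> a _; rewrite mul0r.
by rewrite /bump /= subn0 addn0 subSS subn0.
Qed.

(* f(x1, x2) |-> f(x2, x1) *)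
Definition swap f : fps2 K := FPS2 (fun i j => fcoef f j i).

Lemma swapK : involutive swap.
Proof. by move=> f; apply/fps2P. Qed.

Lemma swapB : {morph swap : f g / f - g}.
Proof. by move=> f g; apply/fps2P. Qed.

Lemma swapM : {morph swap : f g / f * g}.
Proof.
by move=> f g; apply/fps2P => i j; rewrite /= exchange_big.
Qed.

Lemma swap1 : swap 1 = 1.
Proof. by apply/fps2P => i j; rewrite /= andbC. Qed.

HB.instance Definition _ := GRing.isZmodMorphism.Build _ _ swap swapB.
HB.instance Definition _ :=
  GRing.isMonoidMorphism.Build _ _ swap (conj swap1 swapM).

Lemma swap_x1 : swap x1 = x2.
Proof. by apply/fps2P => i j; rewrite /= andbC. Qed.
Lemma swap_x2 : swap x2 = x1.
Proof. by rewrite -swap_x1 swapK. Qed.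

(* Division by x1 - x2: the coefficients of the quotient q are forced by
    q_(i, j) = g_(i + 1, j) + q_(i + 1, j - 1).  [divx12 g] is the genuine
    quotient as soon as g is divisible, in particular for g = f - swap f. *)
Definition divx12 (g : fps2 K) : fps2 K :=
  FPS2 (fun i j => \sum_(k < j.+1) fcoef g (i + k).+1 (j - k)).

Lemma divx12P f : (x1 - x2) * divx12 (f - swap f) = f - swap f.
Proof.
set g := f - swap f.
have diag n : \sum_(k < n.+1) fcoef g k (n - k) = 0.
  rewrite /g; under eq_bigr => k _ do rewrite fcoefB.
  rewrite sumrB [X in _ - X](reindex_inj rev_ord_inj) /=.
  apply/eqP; rewrite subr_eq0; apply/eqP/eq_bigr => k _.
  by rewrite subSS subKn // -ltnS.
apply/fps2P => i j; rewrite mulrBl fcoefB fcoef_x1M fcoef_x2M.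
have telj i' : fcoef (divx12 g) i' j
    = fcoef g i'.+1 j + if j is j'.+1 then fcoef (divx12 g) i'.+1 j' else 0.
  rewrite /= big_ord_recl /= addn0 subn0; congr (_ + _).
  case: j => [|j]; first by rewrite big_ord0.
  by apply: eq_bigr => k _; rewrite /bump /= add1n addnS addSn subSS.
case: i => [|i]; last first.
  by rewrite telj addrK.
rewrite sub0r; have := diag j; rewrite big_ord_recl /= subn0.
case: j {telj} => [|j] /=; first by rewrite big_ord0 addr0 oppr0.
by move/eqP; rewrite addr_eq0 => /eqP ->.
Qed.

Lemma mulx12_inj : injective ( *%R (x1 - x2)).
Proof.
move=> f g /eqP; rewrite -subr_eq0 -mulrBr => /eqP H; apply/eqP.
rewrite -subr_eq0; apply/eqP/fps2P; move: (f - g) H => {f g} q /fps2P H.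
elim=> [|i IH] j.
  by have := H 0%N j.+1; rewrite mulrBl fcoefB fcoef_x1M fcoef_x2M sub0r
    => /eqP; rewrite oppr_eq0 => /eqP.
have := H i.+1 j.+1; rewrite mulrBl fcoefB fcoef_x1M fcoef_x2M IH sub0r.
by move/eqP; rewrite oppr_eq0 => /eqP.
Qed.

Lemma swap_divx12 f : swap (divx12 (f - swap f)) = divx12 (f - swap f).
Proof.
apply: mulx12_inj; rewrite divx12P; apply: (can_inj swapK).
rewrite rmorphM !rmorphB /= !swapK swap_x1 swap_x2.
by rewrite -opprB mulNr divx12P opprB.
Qed.

Definition geom f : fps2 K :=
  FPS2 (fun i j => fcoef (\sum_(n < (i + j).+1) (1 - f) ^+ n) i j).

Let low n f := forall i j, (i + j < n)%N -> fcoef f i j = 0.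

Let lowM m n f g : low m f -> low n g -> low (m + n) (f * g).
Proof.
move=> hf hg i j hij; rewrite fcoefM big1 // => b _; rewrite big1 // => a _.
have [ha hb] := (ltn_ord a, ltn_ord b); rewrite !ltnS in ha hb.
have [h|h] := ltnP (a + b) m; first by rewrite hf // mul0r.
rewrite hg ?mulr0 //.
by rewrite -(ltn_add2l (a + b)) addnACA !subnKC // (leq_trans hij) ?leq_add2r.
Qed.

Let lowX n f : low 1 f -> low n (f ^+ n).
Proof.
by move=> hf; elim: n => [|n IH] //; rewrite exprS -add1n; apply: lowM.
Qed.

Lemma fps2_inv f : fcoef f 0 0 = 1 -> f * geom f = 1.
Proof.
move=> f0; have lf : low 1 (1 - f).
  by case=> [|i] [|j] //; rewrite fcoefB f0 subrr.
have stab N i j : (i + j < N)%N ->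
    fcoef (geom f) i j = fcoef (\sum_(n < N) (1 - f) ^+ n) i j.
  move=> hN; rewrite /= -(subnKC hN) big_split_ord fcoefD.
  rewrite [X in _ = _ + X](_ : _ = 0) ?addr0 //.
  elim/big_rec: _ => // n g _ hg; rewrite fcoefD hg addr0.
  by apply: lowX => //; rewrite ltn_addr.
apply/fps2P => i j; pose N := (i + j).+1.
have -> : fcoef (f * geom f) i j
    = fcoef (f * \sum_(n < N) (1 - f) ^+ n) i j.
  rewrite !fcoefM; apply: eq_bigr => b _; apply: eq_bigr => a _.
  by rewrite (stab N) // /N ltnS leq_add ?leq_subr.
have -> : f * \sum_(n < N) (1 - f) ^+ n = 1 - (1 - f) ^+ N.
  have := subrXX 1 (1 - f) N; rewrite expr1n => ->.
  by rewrite opprB addrCA subrr addr0; congr (_ * _);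
    apply: eq_bigr => k _; rewrite expr1n mul1r.
by rewrite fcoefB (lowX lf) // subr0.
Qed.

Definition invariantS2 : {pred fps2 K} := [pred f | swap f == f].

Lemma invariantS2_subring : subring_closed invariantS2.
Proof.
split=> [|f g|f g]; rewrite !inE ?rmorph1 // => /eqP hf /eqP hg.
  by rewrite rmorphB /= hf hg.
by rewrite rmorphM /= hf hg.
Qed.

HB.instance Definition _ :=
  GRing.isSubringClosed.Build _ invariantS2 invariantS2_subring.

(* K[[E1, E2]], taken as K[[x1, x2]]^{S_2}. *)
Record symfps2 := SymFPS2 { symval :> fps2 K; symvalP : symval \in invariantS2 }.

HB.instance Definition _ := [isSub for symval].
HB.instance Definition _ := [Choice of symfps2 by <:].
HB.instance Definition _ := [SubChoice_isSubComNzRing of symfps2 by <:].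

(* Units are detected and inverted classically. *)
Definition symfps2_unit : {pred symfps2} :=
  [pred f : symfps2 | `[< exists g : symfps2, g * f = 1 >]].

Definition symfps2_inv (f : symfps2) : symfps2 :=
  if pselect (exists g : symfps2, g * f = 1) is left ex
  then projT1 (cid ex) else f.

Lemma symfps2_mulVr : {in symfps2_unit, left_inverse 1 symfps2_inv *%R}.
Proof.
move=> f /asboolP ex; rewrite /symfps2_inv; case: pselect => // ex'.
exact: (projT2 (cid ex')).
Qed.

Lemma symfps2_unitP (f g : symfps2) : g * f = 1 -> f \in symfps2_unit.
Proof. by move=> gf; apply/asboolP; exists g. Qed.

Lemma symfps2_invr_out : {in [predC symfps2_unit], symfps2_inv =1 id}.
Proof.
move=> f; rewrite inE => /asboolPn nex; rewrite /symfps2_inv.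
by case: pselect.
Qed.

HB.instance Definition _ := GRing.ComNzRing_hasMulInverse.Build symfps2
  symfps2_mulVr symfps2_unitP symfps2_invr_out.

End PowerSeriesRing.

Arguments invariantS2 K : clear implicits.

Definition subring_gen (A : pzRingType) (s : seq A) : {pred A} :=
  [pred x | `[< forall P : {pred A},
                  subring_closed P -> {subset s <= P} -> x \in P >]].

(* Meant for A a subring of S and M an A-submodule of S. *)
Definition is_basis (S : comPzRingType) (A M : {pred S})
    (I : eqType) (b : I -> S) : Prop :=
  [/\ forall i, b i \in M,
      forall x, x \in M -> exists (s : seq I) (c : I -> S),
        (forall i, c i \in A) /\ x = \sum_(i <- s) c i * b i
    & forall (s : seq I) (c : I -> S), uniq s -> (forall i, c i \in A) ->
        \sum_(i <- s) c i * b i = 0 -> forall i, i \in s -> c i = 0].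

Definition beta_index := {kl : nat * nat | kl != (0, 0)%N}.

(* Z[beta_(k, l)], as the algebra of the free commutative monoid on the
   indices (k, l) <> (0, 0). *)
Definition kk : comNzRingType := {malg int[{cmonom beta_index}]}.

Definition beta (kl : beta_index) : kk := << ucm kl >>.

(* [insub] fails exactly at (0, 0), where the coefficient is 1. *)
Definition p : fps2 kk :=
  FPS2 (fun k l => if insub (k, l) is Some kl then beta kl else 1).

Definition p12 : fps2 kk := p.
Definition p21 : fps2 kk := swap p.

Definition X1 : fps2 kk := x1 kk.
Definition X2 : fps2 kk := x2 kk.

Definition rho0_ps : fps2 kk := divx12 (p12 - p21).
Definition rho1_ps : fps2 kk := divx12 (X1 * p12 - X2 * p21).
Definition rho_ps : fps2 kk := - (p12 * p21).

Lemma swap_X1p12 : X2 * p21 = swap (X1 * p12).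
Proof. by rewrite swapM swap_x1. Qed.

Lemma rho0_psE : (X1 - X2) * rho0_ps = p12 - p21.
Proof. exact: divx12P. Qed.

Lemma rho1_psE : (X1 - X2) * rho1_ps = X1 * p12 - X2 * p21.
Proof. by rewrite /rho1_ps swap_X1p12 divx12P. Qed.

(* k[[E1, E2]] *)
Definition kE : comUnitRingType := symfps2 kk.

Lemma E1_sym : X1 + X2 \in invariantS2 kk.
Proof. by rewrite inE rmorphD /= swap_x1 swap_x2 addrC. Qed.
Lemma E2_sym : X1 * X2 \in invariantS2 kk.
Proof. by rewrite inE rmorphM /= swap_x1 swap_x2 mulrC. Qed.
Lemma rho0_sym : rho0_ps \in invariantS2 kk.
Proof. by rewrite inE swap_divx12. Qed.
Lemma rho1_sym : rho1_ps \in invariantS2 kk.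
Proof. by rewrite inE /rho1_ps swap_X1p12 swap_divx12. Qed.
Lemma rho_sym : rho_ps \in invariantS2 kk.
Proof. by rewrite inE rmorphN rmorphM /= swapK mulrC. Qed.

Definition E1 : kE := SymFPS2 E1_sym.
Definition E2 : kE := SymFPS2 E2_sym.
Definition rho0 : kE := SymFPS2 rho0_sym.
Definition rho1 : kE := SymFPS2 rho1_sym.
Definition rho : kE := SymFPS2 rho_sym.

Lemma rhoE : rho = - (rho1 ^+ 2 - E1 * rho1 * rho0 + E2 * rho0 ^+ 2).
Proof.
apply: val_inj => /=; do 2!apply: (@mulx12_inj kk).
rewrite -/X1 -/X2 /rho_ps.
have [h0 h1] := (rho0_psE, rho1_psE); move: h0 h1.
move: rho0_ps rho1_ps p12 p21 => r0 r1 a b h0 h1.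
transitivity (- ((X1 - X2) * r1 * ((X1 - X2) * r1)
  - (X1 + X2) * ((X1 - X2) * r1) * ((X1 - X2) * r0)
  + X1 * X2 * ((X1 - X2) * r0 * ((X1 - X2) * r0)))); last by ring.
by rewrite h0 h1; ring.
Qed.

Lemma rho_unit : rho \is a GRing.unit.
Proof.
have p0 : fcoef p 0 0 = 1 by rewrite /= insubF.
have q0 : fcoef (p12 * p21) 0 0 = 1.
  by rewrite fcoefM !big_ord1 /= insubF // mul1r.
have qu := fps2_inv q0.
have qs : swap (p12 * p21) = p12 * p21 by rewrite rmorphM /= swapK mulrC.
have gs : - geom (p12 * p21) \in invariantS2 kk.
  rewrite inE rmorphN; apply/eqP; congr (- _).
  rewrite -[LHS]mulr1 -qu mulrA -{2}qs -rmorphM mulrC [_ * (_ * _)]mulrC.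
  by rewrite qu rmorph1 mulr1.
pose g : kE := SymFPS2 gs.
have vg : rho_ps * symval g = 1 by rewrite /rho_ps mulrNN qu.
have gr : rho * g = 1 by apply: val_inj; exact: vg.
by apply/unitrP; exists g; rewrite mulrC gr.
Qed.

Definition R : {pred kE} := subring_gen [:: E1; E2; rho0; rho1; rho; rho^-1].

(* Z[E1, E2] as a subring of k[[E1, E2]]. *)
Definition ZE : {pred kE} := subring_gen [:: E1; E2].

(* Z[E1, E2, rho0, rho1], with the four indeterminates in this order. *)
Definition P4 : idomainType := mpoly 4 int.

Definition tE1 : P4 := 'X_(@Ordinal 4 0 isT).
Definition tE2 : P4 := 'X_(@Ordinal 4 1 isT).
Definition trho0 : P4 := 'X_(@Ordinal 4 2 isT).
Definition trho1 : P4 := 'X_(@Ordinal 4 3 isT).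

Definition tdelta : P4 := trho1 ^+ 2 - tE1 * trho1 * trho0 + tE2 * trho0 ^+ 2.

(* The localization of P4 at (the powers of) tdelta, inside Frac(P4). *)
Definition loc : {pred {fraction P4}} :=
  [pred x | `[< exists (f : P4) (n : nat),
                  x = tofrac f / tofrac tdelta ^+ n >]].

Lemma tdelta_neq0 : tdelta != 0.
Proof.
apply/eqP => /(congr1 (fun q : mpoly 4 int =>
  q.@[fun i => (i == 3 :> nat)%:R])).
rewrite /tdelta /tE1 /tE2 /trho0 /trho1 meval0.
by rewrite mevalD mevalB !expr2 !mevalM !mevalXU.
Qed.

Lemma loc_subring : subring_closed loc.
Proof.
have d0 n : tofrac tdelta ^+ n != 0.
  by rewrite expf_neq0 // tofrac_eq0 tdelta_neq0.
split=> [|x y|x y].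
- by apply/asboolP; exists 1, 0%N; rewrite tofrac1 expr0 divr1.
- move=> /asboolP[f [m ->]] /asboolP[g [n ->]]; apply/asboolP.
  exists (f * tdelta ^+ n - g * tdelta ^+ m), (m + n)%N.
  by rewrite tofracB !tofracM !tofracXn -mulNr addf_div // mulNr exprD.
- move=> /asboolP[f [m ->]] /asboolP[g [n ->]]; apply/asboolP.
  by exists (f * g), (m + n)%N; rewrite tofracM mulf_div exprD.
Qed.

HB.instance Definition _ := GRing.isSubringClosed.Build _ loc loc_subring.

Record Rbar := MkRbar { rbar_val :> {fraction P4}; rbar_valP : rbar_val \in loc }.

HB.instance Definition _ := [isSub for rbar_val].
HB.instance Definition _ := [Choice of Rbar by <:].
HB.instance Definition _ := [SubChoice_isSubComNzRing of Rbar by <:].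

Lemma loc_tofrac (f : P4) : tofrac f \in loc.
Proof. by apply/asboolP; exists f, 0%N; rewrite expr0 divr1. Qed.

Definition to_Rbar (f : P4) : Rbar := MkRbar (loc_tofrac f).

(* Main.v *)
(* Specialising p to 1 + a x1 + b x2 sends rho0 to a - b and rho1 to
   1 + a (x1 + x2).  Over the quadratic extension F[X] / (X^2 - t1 X + t2) of
   F = Frac Z[t1, t2, t3, t4], the values x1 = X, x2 = t1 - X, a = (t4 - 1) / t1
   and b = a - t3 turn (E1, E2, rho0, rho1) into the generic point
   (t1, t2, t3, t4), so the four power series are algebraically independent.
   The basis spans because rho1^2 = E1 rho1 rho0 - E2 rho0^2 - rho; it is free
   because, after clearing negative powers of rho, one may map into the extension
   of Z[E1, E2][rho0, w] by a root rho1 of that quadratic relation, with w in the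
   place of rho. *)
Require Import Defs.
From HB Require Import structures.
From mathcomp Require Import all_boot all_order all_algebra.
From mathcomp Require Import finmap boolp monalg mpoly ring zify.
Set Implicit Arguments.
Unset Strict Implicit.
Unset Printing Implicit Defensive.

Import GRing.Theory.
Local Open Scope ring_scope.

(** Division by a monic polynomial works over any commutative ring, so in A[X]/(q) a polynomial of
    degree at most 1 is its own remainder. *)
Lemma quadratic_extension (A : comNzRingType) (q : {poly A}) :
  q \is monic -> size q = 3 ->
  exists (Q : comNzRingType) (j : {rmorphism {poly A} -> Q}),
    j q = 0 /\ forall r : {poly A}, (size r < 3)%N -> j r = 0 -> r = 0.
Proof.
move=> qm sq; exists {poly %/ q}, (in_qpoly q).
(* [{poly %/ q}] reduces modulo [mk_monic q], which has a default value unless q is monic and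
   nonconstant. *)
have mq : mk_monic q = q by rewrite /mk_monic sq qm.
split=> [|r sr /(congr1 val)].
  by apply: val_inj; rewrite /= mq Pdiv.RingMonic.rmodpp.
by rewrite /= mq Pdiv.Ring.rmodp_small ?sq.
Qed.

(** * Evaluation of integer polynomials and specialisation of the variables beta *)

Section Evaluation.
Variables (n : nat) (S : comNzRingType) (h : 'I_n -> S).

Definition ev : mpoly n int -> S := mmap (intmul 1) h.

HB.instance Definition _ := GRing.RMorphism.copy ev (mmap (intmul 1) h).

Lemma evX i : ev 'X_i = h i.
Proof. by rewrite /ev mmapX mmap1U. Qed.

(** Every ring morphism is forced on integer coefficients, so only the images of the variables
    matter. *)
Lemma ev_unique (f : {rmorphism mpoly n int -> S}) :
  (forall i, f 'X_i = h i) -> f =1 ev.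
Proof.
move=> fX; have fm m : f 'X_[m] = ev 'X_[m].
  rewrite mpolyXE_id !rmorph_prod; apply: eq_bigr => i _.
  by rewrite !rmorphXn /= fX evX.
have Z c (u : mpoly n int) : c *: u = c%:~R * u.
  by rewrite -mul_mpolyC -[c in c%:MP]intz rmorph_int.
by elim/mpolyind => [|c m u _ _ IH]; rewrite ?rmorph0 // !rmorphD IH Z !rmorphM
  !rmorph_int fm.
Qed.
End Evaluation.

Lemma rmorph_ev n (S T : comNzRingType) (g : {rmorphism S -> T}) h h' :
  (forall i : 'I_n, g (h i) = h' i) -> forall f, g (ev h f) = ev h' f.
Proof.
by move=> gh f; apply: (ev_unique (f := g \o ev h)) => i /=; rewrite evX.
Qed.

Section CmonomEval.
Variables (I : choiceType) (S : comNzRingType) (w : I -> S).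

Definition cmonom_eval (m : cmonom I) : S := \prod_(i <- finsupp m) w i ^+ m i.

(** Lets the products for several monomials run over one common index set, the added exponents being
    0. *)
Lemma cmonom_evalE (d : {fset I}) (m : cmonom I) : (finsupp m `<=` d)%fset ->
  cmonom_eval m = \prod_(i <- d) w i ^+ m i.
Proof.
move=> le; apply: (big_fset_incl _ le) => i _.
by rewrite -cmE_neq0 negbK => /eqP ->.
Qed.

Lemma cmonom_eval_mmorphism : mmorphism cmonom_eval.
Proof.
split=> [m m'|]; last by rewrite /cmonom_eval mdom1 big_seq_fset0.
rewrite (@cmonom_evalE (finsupp m `|` finsupp m')%fset) ?mdomD //.
rewrite (@cmonom_evalE (finsupp m `|` finsupp m')%fset m) ?fsubsetUl //.
rewrite (@cmonom_evalE (finsupp m `|` finsupp m')%fset m') ?fsubsetUr //.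
by rewrite -big_split; apply: eq_bigr => i _; rewrite cmM exprD.
Qed.

HB.instance Definition _ :=
  monalg.isMultiplicative.Build _ _ cmonom_eval cmonom_eval_mmorphism.

Lemma cmonom_evalU i : cmonom_eval (ucm i) = w i.
Proof. by rewrite /cmonom_eval mdomU big_seq_fset1 cmUU. Qed.
End CmonomEval.

(** The universal property of the polynomial ring k, which makes the coefficients of p freely
    specialisable. *)
Lemma kk_free (D : comNzRingType) (w : beta_index -> D) :
  exists s : {rmorphism kk -> D}, forall kl, s (beta kl) = w kl.
Proof.
exists (monalg.mmap (intmul 1) (cmonom_eval w)) => kl.
apply: (etrans (monalg.mmapU _ _)).
by rewrite /= mulr1z mul1r cmonom_evalU.
Qed.

(** * Change of coefficients in power series, and polynomials as power series *)

Section MapFps2.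
Variables (K L : comNzRingType) (s : {rmorphism K -> L}).

Definition map_fps2 (f : fps2 K) : fps2 L := FPS2 (fun i j => s (fcoef f i j)).

Lemma map_fps2B : {morph map_fps2 : f g / f - g}.
Proof. by move=> f g; apply/fps2P => i j /=; rewrite rmorphB. Qed.

Lemma map_fps2M : monoid_morphism map_fps2.
Proof.
split=> [|f g]; apply/fps2P => i j; first by rewrite /= rmorph_nat.
rewrite fcoefM [LHS]rmorph_sum; apply: eq_bigr => b _; rewrite rmorph_sum.
by apply: eq_bigr => a _; rewrite rmorphM.
Qed.

HB.instance Definition _ := GRing.isZmodMorphism.Build _ _ map_fps2 map_fps2B.
HB.instance Definition _ := GRing.isMonoidMorphism.Build _ _ map_fps2 map_fps2M.
End MapFps2.

(* The outer variable of [{poly {poly K}}] is x2, the inner one x1. *)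
Section PolyFps2.
Variable K : comNzRingType.

Definition poly_fps2 (p : {poly {poly K}}) : fps2 K := FPS2 (fun i j => p`_j`_i).

Lemma poly_fps2B : {morph poly_fps2 : f g / f - g}.
Proof. by move=> f g; apply/fps2P => i j /=; rewrite !coefB. Qed.

Lemma poly_fps2M : monoid_morphism poly_fps2.
Proof.
split=> [|f g]; apply/fps2P => i j.
  by rewrite /= coef1; case: j => [|j]; rewrite ?andbF ?andbT ?coef0 //= coef1.
by rewrite fcoefM /= coefM coef_sum; apply: eq_bigr => b _; rewrite coefM.
Qed.

HB.instance Definition _ := GRing.isZmodMorphism.Build _ _ poly_fps2 poly_fps2B.
HB.instance Definition _ := GRing.isMonoidMorphism.Build _ _ poly_fps2 poly_fps2M.

Lemma poly_fps2_inj : injective poly_fps2.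
Proof.
by move=> f g /fps2P fg; apply/polyP => j; apply/polyP => i; apply: fg.
Qed.

Lemma poly_fps2_x1 : poly_fps2 'X%:P = x1 K.
Proof.
apply/fps2P => i j; rewrite /= coefC; case: j => [|j] /=; first by rewrite coefX andbT.
by rewrite coef0 andbF.
Qed.

Lemma poly_fps2_x2 : poly_fps2 'X = x2 K.
Proof.
apply/fps2P => i j; rewrite /= coefX; case: (j == 1%N); rewrite ?coef0 ?andbF //.
by rewrite coef1 andbT.
Qed.
End PolyFps2.

(** The order is that of the indeterminates of [P4]: E1, E2, rho0, rho1. *)
Definition quad {T : Type} (a b c d : T) (i : 'I_4) : T :=
  match val i with 0 => a | 1 => b | 2 => c | _ => d end.

Lemma ord4P (P : 'I_4 -> Prop) :
  P (@Ordinal 4 0 isT) -> P (@Ordinal 4 1 isT) -> P (@Ordinal 4 2 isT) ->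
  P (@Ordinal 4 3 isT) -> forall i, P i.
Proof.
move=> P0 P1 P2 P3 [i hi]; move: (hi).
by case: i hi => [|[|[|[|//]]]] hi hi'; rewrite (bool_irrelevance hi' isT).
Qed.

Lemma rmorph_ev4 (S T : comNzRingType) (g : {rmorphism S -> T}) a b c d a' b' c' d' :
  g a = a' -> g b = b' -> g c = c' -> g d = d' ->
  forall f, g (ev (quad a b c d) f) = ev (quad a' b' c' d') f.
Proof. by move=> ? ? ? ?; apply: rmorph_ev; apply: ord4P. Qed.

(** * The series rho0 and rho1 when p becomes 1 + a x1 + b x2 *)

Section LinearSpecialization.
Variables (K L : comNzRingType) (s : {rmorphism K -> L}) (u : fps2 K) (a b : L).
Hypothesis su : map_fps2 s u = poly_fps2 (1 + a%:P%:P * 'X%:P + b%:P%:P * 'X).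

Lemma map_fps2_x1 : map_fps2 s (x1 K) = poly_fps2 'X%:P.
Proof.
by rewrite poly_fps2_x1; apply/fps2P => i j; rewrite /= rmorph_nat.
Qed.

Lemma map_fps2_x2 : map_fps2 s (x2 K) = poly_fps2 'X.
Proof.
by rewrite poly_fps2_x2; apply/fps2P => i j; rewrite /= rmorph_nat.
Qed.

Let swu : map_fps2 s (swap u) = poly_fps2 (1 + a%:P%:P * 'X + b%:P%:P * 'X%:P).
Proof.
have -> : map_fps2 s (swap u) = swap (map_fps2 s u) by apply/fps2P.
have swapC c : swap (poly_fps2 c%:P%:P) = poly_fps2 (c%:P%:P : {poly {poly L}}).
  by apply/fps2P => -[|i] [|j] /=; rewrite !(coefC, coef0).
rewrite su !(rmorphD, rmorphM, rmorph1) /= !swapC.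
by rewrite poly_fps2_x1 poly_fps2_x2 swap_x1 swap_x2.
Qed.

(** Multiplication by x1 - x2 is injective on series over L, so a polynomial quotient, once
    exhibited, is the quotient. *)
Let divl r t : map_fps2 s ((x1 K - x2 K) * r) = poly_fps2 (('X%:P - 'X) * t) ->
  map_fps2 s r = poly_fps2 t.
Proof.
rewrite [LHS]rmorphM [RHS]rmorphM /= map_fps2B poly_fps2B map_fps2_x1 map_fps2_x2.
by rewrite poly_fps2_x1 poly_fps2_x2 => /mulx12_inj.
Qed.

Lemma map_divx12 r : (x1 K - x2 K) * r = u - swap u ->
  map_fps2 s r = poly_fps2 (a - b)%:P%:P.
Proof.
move=> E; apply: divl; rewrite E map_fps2B su swu -poly_fps2B.
by congr poly_fps2; rewrite !polyCB; ring.
Qed.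

(** The terms in b cancel: x1 (1 + a x1 + b x2) - x2 (1 + a x2 + b x1) is x1 - x2 + a (x1^2 -
    x2^2). *)
Lemma map_divx12_x1 r : (x1 K - x2 K) * r = x1 K * u - x2 K * swap u ->
  map_fps2 s r = poly_fps2 (1 + a%:P%:P * ('X%:P + 'X)).
Proof.
move=> E; apply: divl; rewrite E map_fps2B !rmorphM /= su swu.
rewrite map_fps2_x1 map_fps2_x2 -!rmorphM -poly_fps2B.
by congr poly_fps2; ring.
Qed.
End LinearSpecialization.

(** A relation is pushed forward along g and pulled back along the injective h; the intended g
    specialises series and h embeds polynomials into series. *)
Lemma ev4_transfer (S T U : comNzRingType) (g : {rmorphism S -> T})
    (h : {rmorphism U -> T}) a b c d a' b' c' d' f :
  injective h -> g a = h a' -> g b = h b' -> g c = h c' -> g d = h d' ->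
  ev (quad a b c d) f = 0 -> ev (quad a' b' c' d') f = 0.
Proof.
move=> h_inj ga gb gc gd f0; apply: h_inj; rewrite rmorph0 -[RHS](rmorph0 g) -f0.
by rewrite (rmorph_ev4 ga gb gc gd); apply: rmorph_ev4.
Qed.

(** * Algebraic independence of E1, E2, rho0, rho1 *)

Definition evE : {rmorphism P4 -> kE} := ev (quad E1 E2 rho0 rho1).

(** A relation between the series survives the specialisation of p. It then holds between
    polynomials, where, unlike in power series, x1 and x2 may be given arbitrary values. *)
Lemma ev_polynomials_eq0 (Q : comNzRingType) (a b : Q) (f : mpoly 4 int) :
  ev (quad E1 E2 rho0 rho1) f = 0 ->
  ev (quad ('X%:P + 'X) ('X%:P * 'X) (a - b)%:P%:P
           (1 + a%:P%:P * ('X%:P + 'X))) f = 0 :> {poly {poly Q}}.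
Proof.
move=> f0.
have [s sE] := kk_free (fun kl : beta_index => if val kl == (1, 0)%N then a else
  if val kl == (0, 1)%N then b else 0).
have sp : map_fps2 s p = poly_fps2 (1 + a%:P%:P * 'X%:P + b%:P%:P * 'X).
  apply/fps2P => i j /=.
  transitivity (if (i, j) == (0, 0)%N then 1 else if (i, j) == (1, 0)%N then a else
    if (i, j) == (0, 1)%N then b else 0).
    case: insubP => [kl /negPf hkl ekl|]; first by rewrite sE ekl hkl.
    by rewrite negbK => ->; rewrite rmorph1.
  rewrite -polyCM !coefD coef1 coefC coefCM coefX.
  case: j => [|[|j]]; rewrite /= ?mulr0 ?mulr1 !coef0 ?addr0 ?add0r.
  - by rewrite coef1 coefMX coefC; case: i => [|[|i]] /=; rewrite ?addr0 ?add0r.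
  - by rewrite coefC; case: i => [|[|i]].
  by case: i => [|[|i]].
pose G : {rmorphism kE -> fps2 Q} := map_fps2 s \o val.
have sE1 : G E1 = poly_fps2 ('X%:P + 'X).
  by rewrite [RHS]rmorphD /= -(map_fps2_x1 s) -(map_fps2_x2 s) -[RHS]rmorphD.
have sE2 : G E2 = poly_fps2 ('X%:P * 'X).
  by rewrite [RHS]rmorphM /= -(map_fps2_x1 s) -(map_fps2_x2 s) -[RHS]rmorphM.
have s0 : G rho0 = _ := map_divx12 sp rho0_psE.
have s1 : G rho1 = _ := map_divx12_x1 sp rho1_psE.
exact: (ev4_transfer (@poly_fps2_inj Q) sE1 sE2 s0 s1 f0).
Qed.

(** x and y are formal roots of X^2 - t1 X + t2. The quadratic may be reducible: what counts is that
    F embeds in the quotient. *)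
Lemma solve_generators (F : fieldType) (t1 t2 t3 t4 : F) : t1 != 0 ->
  exists (Q : comNzRingType) (iota : {rmorphism F -> Q}) (x y a b : Q),
    [/\ injective iota, x + y = iota t1, x * y = iota t2, a - b = iota t3
      & 1 + a * iota t1 = iota t4].
Proof.
move=> t1_neq0; pose q : {poly F} := 'X^2 - t1 *: 'X + t2%:P.
have sq' : (size (t2%:P - t1 *: 'X : {poly F})%R < size ('X^2 : {poly F}))%N.
  rewrite size_polyXn ltnS; apply: leq_trans (size_polyD _ _) _.
  rewrite geq_max size_polyN (leq_trans (size_polyC_leq1 _)) //.
  by rewrite (leq_trans (size_scale_leq _ _)) ?size_polyX.
have qE : q = 'X^2 + (t2%:P - t1 *: 'X) by rewrite /q addrAC -addrA.
have qm : q \is monic by rewrite qE monicE lead_coefDl // lead_coefXn.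
have sq : size q = 3 by rewrite qE size_polyDl // size_polyXn.
have [Q [j [jq j_inj]]] := quadratic_extension qm sq.
pose iota : {rmorphism F -> Q} := j \o polyC.
pose c := (t4 - 1) / t1.
exists Q, iota, (j 'X), (iota t1 - j 'X), (iota c), (iota (c - t3)).
have -> : 1 + iota c * iota t1 = iota t4.
  by rewrite -rmorphM divfK // rmorphB rmorph1 addrC subrK.
split=> //; last by rewrite -rmorphB opprB addrC subrK.
- apply: raddf_inj => u ju; apply: polyC_inj; apply: j_inj ju.
  exact: leq_ltn_trans (size_polyC_leq1 _) _.
- by rewrite addrC subrK.
(* The equation x y = t2 is the vanishing of q at the class of X. *)
have : j q = j 'X ^+ 2 - iota t1 * j 'X + iota t2.
  by rewrite /q -mul_polyC rmorphD rmorphB rmorphXn rmorphM.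
rewrite jq; move: (j 'X) (iota t1) (iota t2) => u v w E.
by apply/eqP; rewrite eq_sym -subr_eq0 E; apply/eqP; ring.
Qed.

Lemma evE_inj : injective evE.
Proof.
apply: raddf_inj => f /ev_polynomials_eq0 f0.
have t1_neq0 : tofrac tE1 != 0.
  rewrite tofrac_eq0; apply/eqP => /(congr1 (mcoeff U_(@Ordinal 4 0 isT))).
  by rewrite mcoeff0 mcoeffX eqxx.
have [Q [iota [x [y [a [b [iota_inj xDy xy aBb r1]]]]]]] :=
  solve_generators (tofrac tE2) (tofrac trho0) (tofrac trho1) t1_neq0.
(* The outer variable x2 is sent to y first, then the inner variable x1 to x. *)
pose e : {rmorphism {poly {poly Q}} -> Q} := horner_eval x \o horner_eval y%:P.
have eC u : e u%:P%:P = u by rewrite /= /horner_eval !hornerE.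
have eX1 : e 'X%:P = x by rewrite /= /horner_eval !hornerE.
have eX2 : e 'X = y by rewrite /= /horner_eval !hornerE.
have eE1 : e ('X%:P + 'X) = iota (tofrac tE1) by rewrite rmorphD eX1 eX2.
have eE2 : e ('X%:P * 'X) = iota (tofrac tE2) by rewrite rmorphM eX1 eX2.
have er0 : e (a - b)%:P%:P = iota (tofrac trho0) by rewrite eC.
have er1 : e (1 + a%:P%:P * ('X%:P + 'X)) = iota (tofrac trho1).
  by rewrite rmorphD rmorph1 rmorphM eE1 eC.
have := congr1 e (f0 Q a b); rewrite rmorph0 (rmorph_ev4 eE1 eE2 er0 er1).
(* The value of f at the generic point is the image of f itself under the injection P4 -> Frac P4 ->
   Q, so f = 0. *)
pose g : {rmorphism P4 -> Q} := iota \o @tofrac P4.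
have gX : forall i, g 'X_i =
   quad (iota (tofrac tE1)) (iota (tofrac tE2)) (iota (tofrac trho0))
        (iota (tofrac trho1)) i.
  by apply: ord4P; apply: erefl.
rewrite -(ev_unique gX) => gf; apply/eqP; rewrite -tofrac_eq0 -(inj_eq iota_inj).
by rewrite rmorph0; apply/eqP.
Qed.

(** * Subrings generated by a list *)

Lemma subring_gen_subring (A : pzRingType) (s : seq A) :
  subring_closed (subring_gen s).
Proof.
split=> [|x y /asboolP hx /asboolP hy|x y /asboolP hx /asboolP hy].
- by apply/asboolP => P [P1 _ _] _.
- by apply/asboolP => P cP sP; case: (cP) => _ PB _; apply: PB; [apply: hx | apply: hy].
- by apply/asboolP => P cP sP; case: (cP) => _ _ PM; apply: PM; [apply: hx | apply: hy].
Qed.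

HB.instance Definition _ (A : pzRingType) (s : seq A) :=
  GRing.isSubringClosed.Build A (subring_gen s) (subring_gen_subring s).
HB.instance Definition _ :=
  GRing.isSubringClosed.Build kE R (subring_gen_subring _).
HB.instance Definition _ :=
  GRing.isSubringClosed.Build kE ZE (subring_gen_subring _).

Lemma mem_subring_gen (A : pzRingType) (s : seq A) : {subset s <= subring_gen s}.
Proof. by move=> x sx; apply/asboolP => P _; apply. Qed.

Lemma subring_gen_ind (A : pzRingType) (s : seq A) (P : A -> Prop) :
  P 1 -> (forall x y, P x -> P y -> P (x - y)) ->
  (forall x y, P x -> P y -> P (x * y)) -> (forall x, x \in s -> P x) ->
  forall x, x \in subring_gen s -> P x.
Proof.
move=> P1 PB PM Ps x /asboolP/(_ [pred y | `[< P y >]]) h; apply/asboolP; apply: h.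
  split=> [|y z|y z]; rewrite !inE; first exact/asboolP.
    by move=> /asboolP hy /asboolP hz; apply/asboolP/PB.
  by move=> /asboolP hy /asboolP hz; apply/asboolP/PM.
by move=> y sy; apply/asboolP/Ps.
Qed.

Lemma ev_rpred n (S : comNzRingType) (P : subringClosed S) (h : 'I_n -> S) f :
  (forall i, h i \in P) -> ev h f \in P.
Proof.
move=> hP; rewrite /ev /mmap rpred_sum // => m _; rewrite rpredM ?rpred_int //.
by rewrite /mmap1 rpred_prod // => i _; rewrite rpredX.
Qed.

(** * Linear combinations over a subring *)

Section Span.
Variables (S : comNzRingType) (A : subringClosed S) (I : eqType) (b : I -> S).

(** This is the spanning clause of [is_basis]; the list s may repeat indices. *)
Definition spanned (x : S) := exists (s : seq I) (c : I -> S),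
  (forall i, c i \in A) /\ x = \sum_(i <- s) c i * b i.

Lemma sum_count_mem (u s : seq I) (F : I -> S) : uniq u -> {subset s <= u} ->
  \sum_(i <- u) F i *+ count_mem i s = \sum_(i <- s) F i.
Proof.
move=> uu; elim: s => [|x s IH] su.
  by rewrite big_nil big1 // => i _; rewrite mulr0n.
rewrite big_cons -IH => [|i si]; last by rewrite su // inE si orbT.
have xu : x \in u by rewrite su // mem_head.
under eq_bigr do rewrite /= mulrnDr.
rewrite big_split /= (bigD1_seq x) //= eqxx mulr1n big1 ?addr0 // => i /negPf.
by rewrite eq_sym => ->; rewrite mulr0n.
Qed.

Lemma spanned0 : spanned 0.
Proof. by exists [::], (fun=> 0); rewrite big_nil; split=> // i; apply: rpred0. Qed.

Lemma spannedD x y : spanned x -> spanned y -> spanned (x + y).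
Proof.
move=> [s [c [cA ->]]] [t [d [dA ->]]].
(* Coefficients depend on the index alone, so [s ++ t] cannot carry c on one half and d on the
   other; multiplicities over the duplicate-free union do. *)
exists (undup (s ++ t)), (fun i => c i *+ count_mem i s + d i *+ count_mem i t).
split=> [i|]; first by rewrite rpredD // rpredMn.
under [RHS]eq_bigr do rewrite mulrDl !mulrnAl.
by rewrite big_split /= !sum_count_mem ?undup_uniq // => i;
  rewrite mem_undup mem_cat => ->; rewrite ?orbT.
Qed.

Lemma spannedZ a x : a \in A -> spanned x -> spanned (a * x).
Proof.
move=> aA [s [c [cA ->]]]; exists s, (fun i => a * c i).
split=> [i|]; first by rewrite rpredM.
by rewrite mulr_sumr; apply: eq_bigr => i _; rewrite mulrA.
Qed.

Lemma spannedB x y : spanned x -> spanned y -> spanned (x - y).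
Proof.
move=> sx sy; rewrite -mulN1r; apply: spannedD => //.
by apply: spannedZ => //; rewrite rpredN1.
Qed.

Lemma spanned_basis i : spanned (b i).
Proof.
by exists [:: i], (fun=> 1); rewrite big_seq1 mul1r; split=> // _; apply: rpred1.
Qed.

Lemma spanned_sum J (s : seq J) (F : J -> S) :
  (forall i, spanned (F i)) -> spanned (\sum_(i <- s) F i).
Proof.
move=> sF; elim: s => [|i s IH]; first by rewrite big_nil; apply: spanned0.
by rewrite big_cons; apply: spannedD.
Qed.

Lemma spannedM : (forall i j, spanned (b i * b j)) ->
  forall x y, spanned x -> spanned y -> spanned (x * y).
Proof.
move=> bb x y [s [c [cA ->]]] [t [d [dA ->]]]; rewrite mulr_suml.
apply: spanned_sum => i; rewrite mulr_sumr; apply: spanned_sum => k.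
by rewrite mulrACA; apply: spannedZ => //; rewrite rpredM.
Qed.
End Span.

(* In [Q] = B[r0, w][r1] / (r1^2 - t1 r1 r0 + t2 r0^2 + w), -delta becomes a new
   indeterminate w. *)
Lemma generic_basis (B : comNzRingType) (t1 t2 : B) :
  exists (Q : comNzRingType) (iota : {rmorphism B -> Q}) (r0 r1 w : Q),
    r1 ^+ 2 - iota t1 * r1 * r0 + iota t2 * r0 ^+ 2 = - w /\
    forall (I : eqType) (s : seq I) (e : I -> nat * nat * nat) (c : I -> B),
      uniq s -> {in s &, injective e} -> (forall i, (e i).1.1 < 2)%N ->
      \sum_(i <- s) iota (c i) * (r1 ^+ (e i).1.1 * r0 ^+ (e i).1.2 * w ^+ (e i).2)
        = 0 ->
      forall i, i \in s -> c i = 0.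
Proof.
pose A : comNzRingType := {poly {poly B}}.
pose R0 : A := 'X%:P; pose W : A := 'X.
pose q : {poly A} := 'X^2 + ((t2%:P%:P * R0 ^+ 2 + W)%:P - (t1%:P%:P * R0) *: 'X).
have sq' : (size ((t2%:P%:P * R0 ^+ 2 + W)%:P - (t1%:P%:P * R0) *: 'X : {poly A})%R
    < size ('X^2 : {poly A}))%N.
  rewrite size_polyXn ltnS; apply: leq_trans (size_polyD _ _) _.
  rewrite geq_max size_polyN (leq_trans (size_polyC_leq1 _)) //.
  by rewrite (leq_trans (size_scale_leq _ _)) ?size_polyX.
have qm : q \is monic by rewrite monicE lead_coefDl // lead_coefXn.
have sq : size q = 3 by rewrite size_polyDl // size_polyXn.
have [Q [j [jq j_inj]]] := quadratic_extension qm sq.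
pose k : {rmorphism A -> Q} := j \o polyC.
pose iota : {rmorphism B -> Q} := k \o (polyC \o polyC).
have jC u : j u%:P = k u by [].
have kC u : k u%:P%:P = iota u by [].
exists Q, iota, (k R0), (j 'X), (k W); split.
  have : j q = j 'X ^+ 2 + (iota t2 * k R0 ^+ 2 + k W - iota t1 * k R0 * j 'X).
    rewrite /q -mul_polyC rmorphD rmorphB rmorphXn rmorphM !jC.
    by rewrite (rmorphD k) !(rmorphM k) !kC.
  rewrite jq; move: (j 'X) (k R0) (k W) (iota t1) (iota t2) => u v w x y E.
  by rewrite -[LHS]subr0 E; ring.
move=> I s e c us e_inj e2 sum0.
(* P lifts the relation to polynomials, with r0 innermost, then w, then r1 outermost. Its degree in
   r1 is at most 1, so its vanishing in Q forces P = 0. *)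
pose P : {poly A} := \sum_(i <- s)
  ((((c i)%:P * 'X^((e i).1.2))%:P * 'X^((e i).2))%:P * 'X^((e i).1.1)).
have jP : j P = 0.
  rewrite -[RHS]sum0 /P rmorph_sum; apply: eq_bigr => i _.
  rewrite rmorphM rmorphXn jC (rmorphM k) (rmorphXn k) polyCM (rmorphM k) kC.
  rewrite polyC_exp (rmorphXn k) -!mulrA; congr (_ * _).
  by rewrite mulrA mulrC.

have P0 : P = 0.
  apply: j_inj jP; apply: (@leq_ltn_trans 2) => //.
  apply: leq_trans (size_sum _ _ _) _; apply/bigmax_leqP_seq => i _ _.
  rewrite mul_polyC (leq_trans (size_scale_leq _ _)) // size_polyXn.
  exact: e2.
have coefCXn (T : comNzRingType) (u : T) n m : (u%:P * 'X^n)`_m = u *+ (m == n).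
  by rewrite coefCM coefXn mulr_natr.
move=> i si; have := congr1 (fun f : {poly A} => f`_(e i).1.1`_(e i).2`_(e i).1.2) P0.
rewrite !coef0 /P !coef_sum (bigD1_seq i) //= big_seq_cond big1 ?addr0 => [|l].
  by rewrite !(coefCXn, coefMn) !eqxx.
(* A different index contributes to this coefficient only if all three exponents agree, which
   injectivity of e excludes. *)
case/andP=> sl li; rewrite !(coefCXn, coefMn) -!mulrnA !mulnb.
case: eqP => //= l1; case: eqP => //= l2; case: eqP => //= l3.
case/eqP: li; apply: e_inj => //; move: l1 l2 l3.
by case: (e l) => -[? ?] ?; case: (e i) => -[? ?] ? /= -> -> ->.
Qed.

(** * Universal property of the localization *)

Section Localization.
Variables (S : comUnitRingType) (g : {rmorphism P4 -> S}).
Hypothesis gdelta : g tdelta \is a GRing.unit.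

Let dX_neq0 n : tofrac tdelta ^+ n != 0.
Proof. by rewrite expf_neq0 // tofrac_eq0 tdelta_neq0. Qed.

Let locE (x : Rbar) :
  exists fn : P4 * nat, val x * tofrac tdelta ^+ fn.2 = tofrac fn.1.
Proof.
have /asboolP[f [n xE]] := rbar_valP x.
by exists (f, n); rewrite [val x]xE divfK.
Qed.

Definition loc_lift (x : Rbar) : S :=
  let fn := projT1 (cid (locE x)) in g fn.1 / g tdelta ^+ fn.2.

(** The chosen fraction is irrelevant: two fractions for x agree after cross-multiplication in [P4],
    and [g tdelta] is a unit. *)
Lemma loc_liftE (x : Rbar) f n : val x * tofrac tdelta ^+ n = tofrac f ->
  loc_lift x * g tdelta ^+ n = g f.
Proof.
rewrite /loc_lift; case: (cid _) => -[f' n'] /= E' E.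
have : f' * tdelta ^+ n = f * tdelta ^+ n'.
  apply/eqP; rewrite -tofrac_eq !tofracM !tofracXn -E -E' mulrAC.
  by [].
move/(congr1 g); rewrite !rmorphM !rmorphXn => gE.
by rewrite mulrAC gE mulrK // unitrX.
Qed.

Lemma loc_liftP (x : Rbar) : exists f n,
  val x * tofrac tdelta ^+ n = tofrac f /\ loc_lift x * g tdelta ^+ n = g f.
Proof.
by have [[f n] /= E] := locE x; exists f, n; split; last exact: loc_liftE.
Qed.

Lemma loc_liftB : {morph loc_lift : x y / x - y}.
Proof.
move=> x y; have [f [n [vx lx]]] := loc_liftP x; have [h [m [vy ly]]] := loc_liftP y.
(* Both sides are compared after multiplication by the image of the common denominator. *)
apply: (mulIr (unitrX (n + m) gdelta)).
rewrite (@loc_liftE _ (f * tdelta ^+ m - h * tdelta ^+ n)) /=.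
  rewrite rmorphB !rmorphM !rmorphXn /= -lx -ly mulrBl exprD mulrA.
  by rewrite [X in _ = _ - X]mulrA [X in _ = _ - X]mulrAC.
rewrite tofracB !tofracM !tofracXn -vx -vy mulrBl exprD mulrA.
by rewrite [X in _ - X = _]mulrA [X in _ - X = _]mulrAC.
Qed.

Lemma loc_liftM : monoid_morphism loc_lift.
Proof.
split=> [|x y].
  by rewrite -[LHS]mulr1 -(expr0 (g tdelta)) (@loc_liftE _ 1) ?rmorph1 ?mulr1.
have [f [n [vx lx]]] := loc_liftP x; have [h [m [vy ly]]] := loc_liftP y.
apply: (mulIr (unitrX (n + m) gdelta)).
rewrite (@loc_liftE _ (f * h)) /=; first by rewrite rmorphM -lx -ly exprD mulrACA.
by rewrite tofracM -vx -vy exprD mulrACA.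
Qed.

HB.instance Definition _ := GRing.isZmodMorphism.Build _ _ loc_lift loc_liftB.
HB.instance Definition _ := GRing.isMonoidMorphism.Build _ _ loc_lift loc_liftM.

Lemma loc_lift_to_Rbar f : loc_lift (to_Rbar f) = g f.
Proof. by rewrite -(@loc_liftE (to_Rbar f) f 0) ?expr0 ?mulr1. Qed.

Lemma Rbar_universal : exists phi : {rmorphism Rbar -> S},
  (forall f, phi (to_Rbar f) = g f) /\ (injective g -> injective phi).
Proof.
exists loc_lift; split=> [|g_inj]; first exact: loc_lift_to_Rbar.
apply: raddf_inj => x x0; have [f [n [vx]]] := loc_liftP x.
rewrite x0 mul0r => /esym f0; apply: val_inj; apply: (mulIf (dX_neq0 n)).
by rewrite vx mul0r -tofrac0; congr tofrac; apply: g_inj; rewrite f0 rmorph0.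
Qed.
End Localization.

Lemma to_Rbar_zmod_morphism : zmod_morphism to_Rbar.
Proof. by move=> f h; apply: val_inj; rewrite /= tofracB. Qed.

Lemma to_Rbar_monoid_morphism : monoid_morphism to_Rbar.
Proof. by split=> [|f h]; apply: val_inj; rewrite /= ?tofrac1 ?tofracM. Qed.

HB.instance Definition _ :=
  GRing.isZmodMorphism.Build P4 Rbar to_Rbar to_Rbar_zmod_morphism.
HB.instance Definition _ :=
  GRing.isMonoidMorphism.Build P4 Rbar to_Rbar to_Rbar_monoid_morphism.

(** Every x becomes a polynomial after multiplication by a power of [tdelta], whose image can be
    cancelled. *)
Lemma Rbar_morph_ext (S : comUnitRingType) (phi psi : {rmorphism Rbar -> S}) :
  psi (to_Rbar tdelta) \is a GRing.unit ->
  (forall f, phi (to_Rbar f) = psi (to_Rbar f)) -> phi =1 psi.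
Proof.
move=> du eq_phi x; have /asboolP[f [n xE]] := rbar_valP x.
have fE : to_Rbar f = x * to_Rbar tdelta ^+ n.
  rewrite -rmorphXn; apply: val_inj; rewrite /= tofracXn xE divfK //.
  by rewrite expf_neq0 // tofrac_eq0 tdelta_neq0.
have := eq_phi f; rewrite fE !rmorphM !rmorphXn eq_phi.
exact: (mulIr (unitrX n du)).
Qed.

(** * Polynomial representatives, and the image of the localization *)

Definition pair2 {T : Type} (a b : T) (i : 'I_2) : T :=
  match val i with 0 => a | _ => b end.

Lemma ZE_ev x : x \in ZE -> exists f : mpoly 2 int, x = ev (pair2 E1 E2) f.
Proof.
move: x; apply: (subring_gen_ind (P := fun x => exists f, x = ev (pair2 E1 E2) f)).
- by exists 1; rewrite rmorph1.
- by move=> _ _ [f ->] [h ->]; exists (f - h); rewrite rmorphB.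
- by move=> _ _ [f ->] [h ->]; exists (f * h); rewrite rmorphM.
move=> y; rewrite !inE => /orP[] /eqP ->.
  by exists 'X_(@Ordinal 2 0 isT); rewrite evX.
by exists 'X_(@Ordinal 2 1 isT); rewrite evX.
Qed.

Lemma evE1 : evE tE1 = E1. Proof. exact: evX. Qed.
Lemma evE2 : evE tE2 = E2. Proof. exact: evX. Qed.
Lemma ev_rho0 : evE trho0 = rho0. Proof. exact: evX. Qed.
Lemma ev_rho1 : evE trho1 = rho1. Proof. exact: evX. Qed.

(** Because of this sign, [- tdelta] is the polynomial that stands for rho below. *)
Lemma ev_delta : evE tdelta = - rho.
Proof.
rewrite rhoE opprK /tdelta !expr2 rmorphD rmorphB !rmorphM.
by rewrite evE1 evE2 ev_rho0 ev_rho1.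
Qed.

Lemma ev_delta_unit : evE tdelta \is a GRing.unit.
Proof. by rewrite ev_delta unitrN rho_unit. Qed.

Lemma R_gens : [/\ E1 \in R, E2 \in R, rho0 \in R, rho1 \in R & rho \in R /\ rho^-1 \in R].
Proof. by do 2?split; apply: mem_subring_gen; rewrite !inE eqxx ?orbT. Qed.

Section Image.
Variable phi : {rmorphism Rbar -> kE}.
Hypothesis phiE : forall f, phi (to_Rbar f) = evE f.

Lemma loc_inv_delta : (tofrac tdelta)^-1 \in loc.
Proof. by apply/asboolP; exists 1, 1; rewrite tofrac1 div1r. Qed.

Let phi_inv : phi (MkRbar loc_inv_delta) = - rho^-1.
Proof.
have ru := rho_unit; apply: (mulIr ev_delta_unit).
rewrite -{1}phiE -rmorphM ev_delta mulrNN mulVr // -(rmorph1 phi); congr (phi _).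
by apply: val_inj; rewrite /= mulVf // tofrac_eq0 tdelta_neq0.
Qed.

(** The image is a subring containing the six generators of R. Conversely x is a polynomial times a
    power of the inverse of [tdelta], and phi sends both factors into R. *)
Lemma Rbar_image y : y \in R <-> exists x, phi x = y.
Proof.
split=> [yR|[x <-]].
  have := yR; apply: (subring_gen_ind (P := fun y => exists x, phi x = y)).
  - by exists 1; rewrite rmorph1.
  - by move=> _ _ [x <-] [x' <-]; exists (x - x'); rewrite rmorphB.
  - by move=> _ _ [x <-] [x' <-]; exists (x * x'); rewrite rmorphM.
  move=> {yR}y; rewrite !inE => /or4P[||| /or3P[]] /eqP ->.
  - by exists (to_Rbar tE1); rewrite phiE evE1.
  - by exists (to_Rbar tE2); rewrite phiE evE2.
  - by exists (to_Rbar trho0); rewrite phiE ev_rho0.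
  - by exists (to_Rbar trho1); rewrite phiE ev_rho1.
  - by exists (- to_Rbar tdelta); rewrite rmorphN phiE ev_delta opprK.
  by exists (- MkRbar loc_inv_delta); rewrite rmorphN phi_inv opprK.
have [E1R E2R r0R r1R [rR rVR]] := R_gens.
have /asboolP[f [n xE]] := rbar_valP x.
have -> : x = to_Rbar f * MkRbar loc_inv_delta ^+ n.
  by apply: val_inj; rewrite rmorphM rmorphXn /= xE exprVn.
rewrite rmorphM rmorphXn phiE phi_inv rpredM ?rpredX ?rpredN //.
by apply: ev_rpred; apply: ord4P.
Qed.
End Image.

(** * The basis over Z[E1, E2]: spanning, then freeness *)

Definition basis_elt (n : 'I_2 * nat * int) : kE :=
  rho1 ^+ n.1.1 * rho0 ^+ n.1.2 * rho ^ n.2.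

Section MonomialSpan.
Variables (S : comUnitRingType) (A : subringClosed S) (e1 e2 r0 r1 r : S).
Hypotheses (e1A : e1 \in A) (e2A : e2 \in A) (ru : r \is a GRing.unit).
Hypothesis rE : r = - (r1 ^+ 2 - e1 * r1 * r0 + e2 * r0 ^+ 2).

Let b (n : 'I_2 * nat * int) : S := r1 ^+ n.1.1 * r0 ^+ n.1.2 * r ^ n.2.

(** Only r1^2 needs reduction, through r1^2 = e1 r1 r0 - e2 r0^2 - r. The bound on i suffices for
    products of two basis elements. *)
Lemma spanned_mono i m z : (i < 3)%N -> spanned A b (r1 ^+ i * r0 ^+ m * r ^ z).
Proof.
have b0 m' z' : spanned A b (r0 ^+ m' * r ^ z').
  by have := spanned_basis A b (@Ordinal 2 0 isT, m', z'); rewrite /b /= mul1r.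
have b1 m' z' : spanned A b (r1 * r0 ^+ m' * r ^ z').
  by have := spanned_basis A b (@Ordinal 2 1 isT, m', z').
case: i => [|[|[|//]]] _; first by rewrite mul1r.
  by rewrite expr1.
have -> : r1 ^+ 2 * r0 ^+ m * r ^ z = e1 * (r1 * r0 ^+ m.+1 * r ^ z)
    - e2 * (r0 ^+ m.+2 * r ^ z) - r0 ^+ m * r ^ (z + 1).
  rewrite exprzDr // expr1z !(exprS r0).
  by move: (r ^ z) (r0 ^+ m) => u v; rewrite rE; ring.
by apply: spannedB => //; apply: spannedB; apply: spannedZ.
Qed.

Lemma spanned_monoM n n' : spanned A b (b n * b n').
Proof.
have -> : b n * b n' = r1 ^+ (n.1.1 + n'.1.1) * r0 ^+ (n.1.2 + n'.1.2)
    * r ^ (n.2 + n'.2).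
  by rewrite /b !exprD exprzDr // mulrACA; congr (_ * _); rewrite mulrACA.
by apply: spanned_mono; case: n n' => -[[[|[]]] //= _ ? ?] [[[[|[]]] //= _ ?] ?].
Qed.
End MonomialSpan.

Lemma R_spanned x : x \in R -> spanned ZE basis_elt x.
Proof.
have E1Z : E1 \in ZE by rewrite mem_subring_gen // !inE eqxx.
have E2Z : E2 \in ZE by rewrite mem_subring_gen // !inE eqxx orbT.
have mono i m z : (i < 3)%N -> spanned ZE basis_elt (rho1 ^+ i * rho0 ^+ m * rho ^ z).
  exact: (spanned_mono (A := ZE) E1Z E2Z rho_unit rhoE).
have one : spanned ZE basis_elt 1.
  by have := mono 0 0 0 isT; rewrite !expr0 expr0z !mulr1.
apply: (subring_gen_ind (P := spanned ZE basis_elt)) => //.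
- exact: spannedB.
- by apply: spannedM => n n'; exact: (spanned_monoM (A := ZE) E1Z E2Z rho_unit rhoE).
move=> y; rewrite !inE => /or4P[||| /or3P[]] /eqP ->.
- by rewrite -[E1]mulr1; apply: spannedZ.
- by rewrite -[E2]mulr1; apply: spannedZ.
- by have := mono 0 1 0 isT; rewrite expr0 expr0z mul1r mulr1 expr1.
- by have := mono 1 0 0 isT; rewrite expr0 expr0z !mulr1 expr1.
- by have := mono 0 0 1 isT; rewrite !expr0 expr1z !mul1r.
by have := mono 0 0 (-1) isT; rewrite !expr0 !mul1r -invr_expz expr1z.
Qed.

Lemma basis_free (s : seq ('I_2 * nat * int)) (c : 'I_2 * nat * int -> kE) :
  uniq s -> (forall n, c n \in ZE) -> \sum_(n <- s) c n * basis_elt n = 0 ->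
  forall n, n \in s -> c n = 0.
Proof.
move=> us cZ sum0.
pose g n := projT1 (cid (ZE_ev (cZ n))).
have cE n : c n = ev (pair2 E1 E2) (g n) := projT2 (cid (ZE_ev (cZ n))).
(* N bounds every |n.2| with n in s, so multiplying by rho^N clears the negative powers; on s the
   absolute value in [k] then changes nothing. *)
pose N := (\sum_(n <- s) absz n.2)%N.
pose k (n : 'I_2 * nat * int) := absz (n.2 + N%:Z).
have kE n : n \in s -> (k n)%:Z = n.2 + N%:Z.
  move=> ns; rewrite /k gez0_abs //.
  have : (absz n.2 <= N)%N by rewrite /N (bigD1_seq n) //= leq_addr.
  by clear; case: n => [_ z] /=; lia.
pose G n : P4 := ev (pair2 tE1 tE2) (g n).
have GE n : evE (G n) = c n.
  rewrite cE /G; apply: rmorph_ev => -[[|i] hi]; [exact: evE1|exact: evE2].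
(* F lifts the cleared relation to [P4], with [- tdelta] in the place of rho; it vanishes because
   [evE] is injective. *)
pose F : P4 := \sum_(n <- s)
  G n * (trho1 ^+ n.1.1 * trho0 ^+ n.1.2 * (- tdelta) ^+ k n).
have F0 : F = 0.
  have sumN : \sum_(n <- s) c n * basis_elt n * rho ^+ N = 0.
    by rewrite -mulr_suml sum0 mul0r.
  apply: evE_inj; rewrite rmorph0 -[RHS]sumN rmorph_sum.
  apply: eq_big_seq => n ns; rewrite !(rmorphM evE) !(rmorphXn evE) GE.
  rewrite rmorphN ev_delta opprK ev_rho0 ev_rho1 /basis_elt -!mulrA.
  do 3 congr (_ * _); rewrite -[rho ^+ k n]/(rho ^ (k n)) kE // exprzDr ?rho_unit //.
have [Q [iota [r0 [r1 [w [wE free]]]]]] :=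
  generic_basis ('X_(@Ordinal 2 0 isT) : mpoly 2 int) 'X_(@Ordinal 2 1 isT).
set y1 : mpoly 2 int := 'X_(@Ordinal 2 0 isT) in wE.
set y2 : mpoly 2 int := 'X_(@Ordinal 2 1 isT) in wE.
(* h carries F = 0 into the generic model, where the monomials are independent over Z[y1, y2]; this
   kills the polynomials [g n] and hence the coefficients [c n]. *)
pose h : {rmorphism P4 -> Q} := ev (quad (iota y1) (iota y2) r0 r1).
have h1 : h tE1 = iota y1 by apply: evX.
have h2 : h tE2 = iota y2 by apply: evX.
have hr0 : h trho0 = r0 by apply: evX.
have hr1 : h trho1 = r1 by apply: evX.
have hd : h (- tdelta) = w.
  rewrite -[w]opprK -wE rmorphN /tdelta !expr2 rmorphD rmorphB !rmorphM.
  by rewrite h1 h2 hr0 hr1.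
have hG n : h (G n) = iota (g n).
  transitivity (ev (pair2 (iota y1) (iota y2)) (g n)).
    by apply: rmorph_ev => -[[|i] hi].
  by apply/esym/(ev_unique (f := iota)) => -[[|[|//]] hi]; congr (iota 'X_ _); apply: val_inj.
have e_inj : {in s &, injective (fun n => (nat_of_ord n.1.1, n.1.2, k n))}.
  move=> n m ns ms [/val_inj e1 e2 /(congr1 Posz)]; rewrite !kE // => /addIr e3.
  by move: e1 e2 e3; case: n m {ns ms} => -[? ?] ? [[? ?] ?] /= -> -> ->.
move=> n ns; rewrite cE (free _ _ _ g us e_inj _ _ n ns) ?rmorph0 // => [m|].
  exact: ltn_ord.
rewrite -[RHS](rmorph0 h) -F0 /F rmorph_sum; apply: eq_bigr => m _.
by rewrite (rmorphM h) hG !(rmorphM h) !(rmorphXn h) hd hr0 hr1.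
Qed.

Theorem corollary4p3 :
  (exists phi : {rmorphism Rbar -> kE},
     [/\ [/\ phi (to_Rbar tE1) = E1, phi (to_Rbar tE2) = E2,
             phi (to_Rbar trho0) = rho0 & phi (to_Rbar trho1) = rho1],
         (forall psi : {rmorphism Rbar -> kE},
            [/\ psi (to_Rbar tE1) = E1, psi (to_Rbar tE2) = E2,
                psi (to_Rbar trho0) = rho0 & psi (to_Rbar trho1) = rho1] ->
            psi =1 phi),
         injective phi
       & forall y : kE, y \in R <-> exists x : Rbar, phi x = y])
  /\ is_basis ZE R
       (fun n : 'I_2 * nat * int => rho1 ^+ n.1.1 * rho0 ^+ n.1.2 * rho ^ n.2).
Proof.
split.
  have [phi [phiE phi_inj]] := Rbar_universal ev_delta_unit.
  exists phi; split.
  - by rewrite !phiE evE1 evE2 ev_rho0 ev_rho1.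
  - move=> psi [p1 p2 p3 p4]; apply: Rbar_morph_ext => [|f].
      by rewrite phiE ev_delta_unit.
    (* On polynomials psi is determined by its values at the four variables, hence is evaluation at
       the four series. *)
    pose g : {rmorphism P4 -> kE} := psi \o to_Rbar.
    rewrite phiE -[LHS]/(g f); apply: (ev_unique (f := g)).
    by apply: ord4P.
  - exact/phi_inj/evE_inj.
  - exact: Rbar_image.
have [_ _ r0R r1R [rR rVR]] := R_gens.
split; [|exact: R_spanned|exact: basis_free].
move=> n; rewrite !rpredM ?rpredX //.
(* Nonnegative exponents use that rho lies in R, negative ones that its inverse does. *)
by case: n.2 => m; rewrite ?NegzE -?exprnN ?rpredX // -exprVn rpredX.
Qed.
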